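(* Let $n\geq 2$ and $r\geq 1$ be integers and let $A_0,A_1,\ldots,A_r,B_3,\ldots,B_n$ be $n+r-1$ arbitrary positive semi-definite complex Hermitian $n\times n$ matrices. Denote $$d_{ij}=D(A_i,A_j,B_3,\ldots,B_n),\qquad 0\leq i,j\leq r.$$ Then $$\det\Big(\big(d_{0i}d_{0j}-d_{00}d_{ij}\big)_{i,j=1}^r\Big)\geq0\qquad\text{and}\qquad(-1)^r\det\Big(\big(d_{ij}\big)_{i,j=0}^r\Big)\geq0.$$
   Context: For complex $n\times n$ matrices $A_r=(a^{(r)}_{ij})_{i,j=1}^n$, $r=1,\ldots,n$, the mixed discriminant is $$D(A_1,\ldots,A_n):=\frac{1}{n!}\sum_{\sigma\in S_n}\det\big(a^{(\sigma(j))}_{ij}\big)_{i,j=1}^n,$$ i.e. in the summand for $\sigma$ the $j$-th column of the determinant is the $j$-th column of $A_{\sigma(j)}$. For $n=2$ the list $B_3,\ldots,B_n$ is empty. *)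

(* Defs.v *)
From mathcomp Require Import all_boot all_order all_algebra all_fingroup.
From mathcomp Require Import reals.
From mathcomp Require Import complex.

Set Implicit Arguments.
Unset Strict Implicit.
Unset Printing Implicit Defensive.

Import GRing.Theory Num.Theory.
Local Open Scope ring_scope.
Local Open Scope sesquilinear_scope.

Definition mixed_discriminant (F : fieldType) n (A : n.-tuple 'M[F]_n) : F :=
  (n`!%:R)^-1 * \sum_(s : 'S_n) \det (\matrix_(i, j) tnth A (s j) i j).

(* In a numClosedFieldType, [0 <= z] also says that [z] is real. *)
Definition psdmx (C : numClosedFieldType) n (M : 'M[C]_n) : Prop :=
  M \is hermsymmx /\ forall x : 'cV[C]_n, 0 <= (x^t* *m M *m x) 0 0.

(* Main.v *)
(* Write Q(X, Y) = D(X, Y, B_3, ..., B_n). The key point is Alexandrov's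
   inequality Q(A, X)^2 >= Q(A, A) Q(X, X) for A and the B_i positive definite and
   X Hermitian. It follows from stability: D(Z, ..., Z, B_(m+1), ..., B_n) <> 0
   whenever Z = X + iY with Y positive definite. This is clear for det Z, and it
   survives replacing one more Z by a matrix B, because
   f(t) = D(Z + tB, ..., Z + tB, B_(m+1), ..., B_n) has all its roots in the open
   lower half plane, so that the imaginary part of f'(0)/f(0) is negative.
   With m = 2 the real quadratic polynomial Q(X + sA, X + sA) has only real roots,
   and its discriminant is nonnegative.

   Applied to real combinations X of A_1, ..., A_r, the inequality says that the
   matrix (d_0i d_0j - d_00 d_ij) is positive semi-definite; up to scaling it is the
   opposite of the Schur complement of d_00 in (d_ij). Both determinants are
   polynomials in e after adding e I to all matrices, which reduces the
   semi-definite case to the definite one. *)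
Require Import Defs.
From mathcomp Require Import all_boot all_order all_algebra all_fingroup.
From mathcomp Require Import reals.
From mathcomp Require Import complex.
From mathcomp Require Import ring.

Set Implicit Arguments.
Unset Strict Implicit.
Unset Printing Implicit Defensive.

Import Order.TTheory GRing.Theory Num.Theory.
Local Open Scope ring_scope.
Local Open Scope sesquilinear_scope.

(** * Multilinear algebra of mixed discriminants over commutative rings *)

Lemma deriv_prod (R : comNzRingType) (I : finType) (p : I -> {poly R}) :
  (\prod_i p i)^`() = \sum_i \prod_l (if l == i then (p l)^`() else p l).
Proof.
have deriv_seq (r : seq I) : uniq r -> (\prod_(i <- r) p i)^`() =
    \sum_(i <- r) \prod_(l <- r) (if l == i then (p l)^`() else p l).
  elim: r => [|x r IHr] /= => [_|/andP[xNr /IHr {}IHr]].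
    by rewrite !big_nil derivC.
  rewrite !big_cons derivM eqxx IHr; congr (_ * _ + _).
    rewrite big_seq [RHS]big_seq; apply: eq_bigr => i ir.
    by case: eqP => // ix; rewrite -ix ir in xNr.
  rewrite big_distrr /= big_seq [RHS]big_seq; apply: eq_bigr => i ir.
  by rewrite big_cons; case: eqP => // xi; rewrite xi ir in xNr.
by rewrite deriv_seq // index_enum_uniq.
Qed.

(* [n`!] times the mixed discriminant, written so that rows and columns play
   symmetric roles; it makes sense over polynomial rings as well. *)
Definition mixdet (R : comNzRingType) n (A : 'I_n -> 'M[R]_n) : R :=
  \sum_(s : 'S_n) \sum_(t : 'S_n) (-1) ^+ s * (-1) ^+ t *
    \prod_i A i (s i) (t i).

(** The inverse of the column permutation becomes the permutation that distributes the matrices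
    among the columns; the signs then combine into that of one determinant term. *)
Lemma mixdet_sum_det (R : comNzRingType) n (A : 'I_n -> 'M[R]_n) :
  mixdet A = \sum_(s : 'S_n) \det (\matrix_(i, j) A (s j) i j).
Proof.
rewrite /mixdet exchange_big /= (reindex_inj invg_inj) /=.
apply: eq_bigr => s _; rewrite -det_tr /determinant.
rewrite (reindex_inj (mulgI s^-1%g)) /=.
apply: eq_bigr => t _; rewrite odd_permM odd_permV signr_addb.
congr (_ * _); first by rewrite mulrAC -expr2 sqrr_sign mul1r.
rewrite (reindex_inj (@perm_inj _ s)) /=; apply: eq_bigr => i _.
by rewrite !mxE permM !permK.
Qed.

Lemma mixed_discriminantE (F : fieldType) n (A : n.-tuple 'M[F]_n) :
  mixed_discriminant A = (n`!%:R)^-1 * mixdet (tnth A).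
Proof. by rewrite mixdet_sum_det. Qed.

Lemma mixdet_const (R : comNzRingType) n (Z : 'M[R]_n) :
  mixdet (fun => Z) = n`!%:R * \det Z.
Proof.
rewrite mixdet_sum_det mulr_natl -(card_Sn n) -sumr_const.
apply: eq_bigr => s _; congr (\det _).
by apply/matrixP => i j; rewrite mxE.
Qed.

Lemma eq_mixdet (R : comNzRingType) n (A B : 'I_n -> 'M[R]_n) :
  A =1 B -> mixdet A = mixdet B.
Proof.
move=> AB; do 2![apply: eq_bigr => ? _]; congr (_ * _).
by apply: eq_bigr => i _; rewrite AB.
Qed.

Lemma mixdet_perm (R : comNzRingType) n (A : 'I_n -> 'M[R]_n) (s : 'S_n) :
  mixdet (fun i => A (s i)) = mixdet A.
Proof.
rewrite !mixdet_sum_det [RHS](reindex_inj (mulIg s)) /=.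
apply: eq_bigr => t _; congr (\det _).
by apply/matrixP => i j; rewrite !mxE permM.
Qed.

Lemma mixdet_tr (R : comNzRingType) n (A : 'I_n -> 'M[R]_n) :
  mixdet (fun i => (A i)^T) = mixdet A.
Proof.
rewrite /mixdet exchange_big; do 2![apply: eq_bigr => ? _].
by congr (_ * _); [rewrite mulrC | apply: eq_bigr => i _; rewrite mxE].
Qed.

Lemma rmorph_mixdet (R S : comNzRingType) (f : {rmorphism R -> S}) n
    (A : 'I_n -> 'M[R]_n) :
  f (mixdet A) = mixdet (fun i => map_mx f (A i)).
Proof.
rewrite rmorph_sum; apply: eq_bigr => s _.
rewrite rmorph_sum; apply: eq_bigr => t _.
rewrite !rmorphM !rmorph_sign rmorph_prod; congr (_ * _).
by apply: eq_bigr => i _; rewrite mxE.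
Qed.

Lemma mixdet_linear (R : comNzRingType) n (i : 'I_n) (a : R)
    (A B C : 'I_n -> 'M[R]_n) :
    (forall j, j != i -> A j = C j) -> (forall j, j != i -> B j = C j) ->
    C i = a *: A i + B i ->
  mixdet C = a * mixdet A + mixdet B.
Proof.
move=> AC BC Ci; rewrite /mixdet mulr_sumr -big_split; apply: eq_bigr => s _.
rewrite mulr_sumr -big_split; apply: eq_bigr => t _ /=.
rewrite mulrCA -mulrDr; congr (_ * _).
rewrite (bigD1 i) // [X in _ = _ * X + _](bigD1 i) //.
rewrite [X in _ = _ + X](bigD1 i) //= Ci !mxE mulrDl mulrA; congr (_ * _ + _ * _).
  by apply: eq_bigr => j /AC->.
by apply: eq_bigr => j /BC->.
Qed.

Lemma mixdet_scale (R : comNzRingType) n (A : 'I_n -> 'M[R]_n) (c : 'I_n -> R) :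
  mixdet (fun i => c i *: A i) = \prod_i c i * mixdet A.
Proof.
rewrite /mixdet mulr_sumr; apply: eq_bigr => s _.
rewrite mulr_sumr; apply: eq_bigr => t _ /=.
rewrite mulrCA -big_split; congr (_ * _).
by apply: eq_bigr => j _; rewrite mxE.
Qed.

(** Setting some [Q i] to [0] freezes those slots, so that only the others move along the line. *)
Definition mixdet_line (R : comNzRingType) n (P Q : 'I_n -> 'M[R]_n) : {poly R} :=
  mixdet (fun i => map_mx polyC (P i) + 'X *: map_mx polyC (Q i)).

Lemma horner_mixdet_line (R : comNzRingType) n (P Q : 'I_n -> 'M[R]_n) x :
  (mixdet_line P Q).[x] = mixdet (fun i => P i + x *: Q i).
Proof.
rewrite -horner_evalE rmorph_mixdet; apply: eq_mixdet => i.
by apply/matrixP => j k; rewrite !mxE /= horner_evalE !hornerE.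
Qed.

Lemma deriv_mixdet_line (R : comNzRingType) n (P Q : 'I_n -> 'M[R]_n) :
  (mixdet_line P Q)^`().[0] =
  \sum_i mixdet (fun l => if l == i then Q l else P l).
Proof.
rewrite /mixdet_line /mixdet raddf_sum horner_sum exchange_big.
apply: eq_bigr => s _; rewrite raddf_sum horner_sum exchange_big.
apply: eq_bigr => t _ /=; rewrite -mulr_sumr.
rewrite -signr_addb derivM.
have -> : (((-1) ^+ (s (+) t) : {poly R})^`()) = 0.
  by case: (s (+) t); rewrite ?expr1 ?derivN derivC ?oppr0.
rewrite mul0r add0r hornerM; congr (_ * _).
  rewrite -signr_addb; by case: (s (+) t); rewrite ?expr1 ?expr0 ?hornerN hornerC.
rewrite deriv_prod horner_sum; apply: eq_bigr => i _.
rewrite horner_prod; apply: eq_bigr => l _.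
by rewrite !mxE; case: eqP => _; rewrite ?derivE !hornerE.
Qed.

(** * Limits of polynomial inequalities as e decreases to 0 *)

Lemma le0_of_le_linear (C : numClosedFieldType) (k c : C) : 0 <= k -> 0 <= c ->
  (forall e, 0 < e -> e <= 1 -> k <= c * e) -> k = 0.
Proof.
move=> k0 c0 kle; apply/eqP/negP => /negP kN0.
have kgt0 : 0 < k by rewrite lt_def kN0.
have ck0 : 0 < 2 * (c + k) by rewrite mulr_gt0 // ltr_wpDl.
(* This value of e is at most 1 and turns the bound into 2 (c + k) <= c. *)
have := kle (k / (2 * (c + k))); rewrite divr_gt0 // => /(_ isT).
have -> : k / (2 * (c + k)) <= 1.
  rewrite ler_pdivrMr // mul1r mulr_natl mulr2n -addrA ler_wpDl //.
  by rewrite ler_wpDr // addr_ge0.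
move=> /(_ isT); rewrite mulrA ler_pdivlMr // mulrC ler_pM2r // => h.
have : c + k <= c by apply: le_trans h; rewrite ler_peMl ?ler1n // addr_ge0.
by rewrite gerDl => /le_gtF; rewrite kgt0.
Qed.

(** Write p = q X + c. For 0 < e <= 1 the term q(e) e is bounded by a multiple of e, so c is
    arbitrarily close to nonnegative numbers. *)
Lemma horner_ge0_at0 (C : numClosedFieldType) (p : {poly C}) :
  (forall e, 0 < e -> 0 <= p.[e]) -> 0 <= p.[0].
Proof.
elim/poly_ind: p => [|q c _] pge0; first by rewrite horner0.
rewrite !hornerE.
have {}pge0 e : 0 < e -> 0 <= q.[e] * e + c.
  by move=> /pge0; rewrite !hornerE.
have [b b0 qb] : exists2 b, 0 <= b &
    forall e, 0 < e -> e <= 1 -> `|q.[e] * e| <= b * e.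
  exists (\sum_(i < size q) `|q`_i|); first exact: sumr_ge0.
  move=> e e0 e1; rewrite normrM (gtr0_norm e0) ler_pM2r // horner_coef.
  apply: le_trans (ler_norm_sum _ _ _) _; apply: ler_sum => i _.
  rewrite normrM normrX (gtr0_norm e0) ler_piMr //.
  by rewrite exprn_ile1 // ltW.
(* The order is partial, so c must be shown real before its sign is discussed: c differs from its
   conjugate by at most 2 b e. *)
have cR : c \is Num.real.
  apply/CrealP/eqP; rewrite -subr_eq0 -normr_eq0; apply/eqP.
  have b20 : 0 <= b + b by rewrite addr_ge0.
  apply: (le0_of_le_linear _ b20) => // e e0 e1.
  have := geC0_conj (pge0 e e0); rewrite rmorphD /= => ecj.
  have -> : c^* - c = q.[e] * e - (q.[e] * e)^*.
    by apply/eqP; rewrite subr_eq addrAC -ecj addrAC subrr add0r.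
  apply: le_trans (ler_normB _ _) _.
  by rewrite norm_conjC mulrDl lerD ?qb.
have [//|cN] := real_leP (real0 C) cR.
have c0 : 0 <= - c by rewrite oppr_ge0 ltW.
suff /eqP : - c = 0 by rewrite oppr_eq0 lt_eqF.
apply: (le0_of_le_linear c0 b0) => e e0 e1.
have h : - c <= q.[e] * e by rewrite -subr_ge0 opprK pge0.
apply: le_trans (qb e e0 e1).
exact: le_trans h (real_ler_norm (ger0_real (le_trans c0 h))).
Qed.

Lemma horner_eq0_at0 (C : numClosedFieldType) (p : {poly C}) :
  (forall e, 0 < e -> p.[e] = 0) -> p.[0] = 0.
Proof.
move=> p0; apply/le_anti/andP; split; last first.
  by apply: horner_ge0_at0 => e /p0->.
rewrite -oppr_ge0 -hornerN; apply: horner_ge0_at0 => e /p0.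
by rewrite hornerN => ->; rewrite oppr0.
Qed.

(** * Logarithmic derivatives and roots in the lower half plane *)

(** Here [w] is the sum of -1/z over the roots, and Im z < 0 makes Im (-1/z) negative. The weak
    bound covers the empty product, where [w] is 0. *)
Lemma log_deriv_prod_XsubC (C : numClosedFieldType) (s : seq C) :
    (forall z, z \in s -> 'Im z < 0) ->
  exists w, [/\ (\prod_(z <- s) ('X - z%:P))^`().[0] =
                  w * (\prod_(z <- s) ('X - z%:P)).[0],
                'Im w <= 0 & s != [::] -> 'Im w < 0].
Proof.
elim: s => [|z s IHs] sIm.
  by exists 0; rewrite big_nil derivC horner0 mul0r raddf0.
have [x xs|w [wE w_le0 _]] := IHs; first by rewrite sIm // inE xs orbT.
have zIm : 'Im z < 0 by rewrite sIm // mem_head.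
have zN0 : z != 0 by apply: contraTneq zIm => ->; rewrite raddf0 ltxx.
have ltw : 'Im (w - z^-1) < 0.
  rewrite raddfB /= ImV mulNr opprK -[ltRHS]addr0 ler_ltD //.
  by rewrite pmulr_llt0 // invr_gt0 exprn_gt0 // normr_gt0.
exists (w - z^-1); split; rewrite ?(ltW ltw) //.
by rewrite big_cons derivM hornerD !hornerM wE derivXsubC hornerC hornerXsubC; field.
Qed.

(** * Positive definite matrices and the tube over their cone *)

Definition pdmx (C : numClosedFieldType) n (M : 'M[C]_n) : Prop :=
  M \is hermsymmx /\ forall x : 'cV[C]_n, x != 0 -> 0 < (x^t* *m M *m x) 0 0.

(** The matrix analogue of the open upper half plane, on which stability is stated. *)
Definition tubemx (C : numClosedFieldType) n (Z : 'M[C]_n) : Prop :=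
  exists X Y, [/\ X \is hermsymmx, pdmx Y & Z = X + 'i *: Y].

Section Positive.
Variables (C : numClosedFieldType) (n : nat).
Implicit Types (A B X Y Z M : 'M[C]_n) (x : 'cV[C]_n).

Lemma hermmxP M : reflect (M^t* = M) (M \is hermsymmx).
Proof.
by apply: (iffP (is_hermitianmxP _ _ _)); rewrite expr0 scale1r => /esym.
Qed.

Lemma hermmxD A B : A \is hermsymmx -> B \is hermsymmx -> A + B \is hermsymmx.
Proof.
by move=> /hermmxP hA /hermmxP hB; apply/hermmxP; rewrite linearD map_mxD hA hB.
Qed.

Lemma hermmxZ a A : a \is Num.real -> A \is hermsymmx -> a *: A \is hermsymmx.
Proof.
move=> /CrealP aR /hermmxP hA; apply/hermmxP.
by rewrite linearZ /= map_mxZ hA; congr (_ *: _).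
Qed.

Lemma hermmx_form_real M x : M \is hermsymmx -> (x^t* *m M *m x) 0 0 \is Num.real.
Proof.
move=> /hermmxP hM; apply/CrealP.
have {2}-> : x^t* *m M *m x = (x^t* *m M *m x)^t*.
  by rewrite !trmx_mul !map_mxM trmxCK hM mulmxA.
by rewrite !mxE.
Qed.

Lemma mxformD A B x : (x^t* *m (A + B) *m x) 0 0 =
  (x^t* *m A *m x) 0 0 + (x^t* *m B *m x) 0 0.
Proof. by rewrite mulmxDr mulmxDl mxE. Qed.

Lemma mxformZ a A x : (x^t* *m (a *: A) *m x) 0 0 = a * (x^t* *m A *m x) 0 0.
Proof. by rewrite -scalemxAr -scalemxAl mxE. Qed.

Lemma pdmx_psd M : pdmx M -> psdmx M.
Proof.
move=> [hM pM]; split=> // x; have [->|/pM/ltW//] := eqVneq x 0.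
by rewrite mulmx0 mxE.
Qed.

Lemma pdmxD A B : pdmx A -> psdmx B -> pdmx (A + B).
Proof.
move=> [hA pA] [hB pB]; split=> [|x x0]; first exact: hermmxD.
by rewrite mxformD ltr_wpDr ?pA.
Qed.

Lemma psdmxZ a A : 0 <= a -> psdmx A -> psdmx (a *: A).
Proof.
move=> a0 [hA pA]; split=> [|x]; first by rewrite hermmxZ // ger0_real.
by rewrite mxformZ mulr_ge0.
Qed.

Lemma pdmxZ a A : 0 < a -> pdmx A -> pdmx (a *: A).
Proof.
move=> a0 [hA pA]; split=> [|x x0]; first by rewrite hermmxZ // gtr0_real.
by rewrite mxformZ mulr_gt0 ?pA.
Qed.

Lemma pdmx1 : pdmx (1%:M : 'M[C]_n).
Proof.
split=> [|x x0]; first by apply/hermmxP; rewrite trmx1 map_mx1.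
have [i xi] : exists i, x i 0 != 0 by apply/cV0Pn.
rewrite mulmx1 mxE (bigD1 i) //= ltr_pwDl ?mxE //.
  by rewrite mulrC -normCK exprn_gt0 // normr_gt0.
by apply: sumr_ge0 => j _; rewrite !mxE mulrC -normCK exprn_ge0.
Qed.

Lemma tubemx_imZ B : pdmx B -> tubemx ('i *: B).
Proof.
move=> pB; exists 0, B; split=> //; last by rewrite add0r.
by apply/hermmxP; rewrite trmx0 map_mx0.
Qed.

Lemma tubemxD Z B t : tubemx Z -> pdmx B -> 0 <= 'Im t -> tubemx (Z + t *: B).
Proof.
move=> [X [Y [hX pY ->]]] pB t0; exists (X + 'Re t *: B), (Y + 'Im t *: B).
split.
- by rewrite hermmxD // hermmxZ ?Creal_Re //; case: pB.
- exact: pdmxD (psdmxZ t0 (pdmx_psd pB)).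
- by rewrite [in LHS](Crect t) scalerDl scalerDr scalerA addrACA.
Qed.

(** At a kernel vector the form of Z vanishes, but its imaginary part is the form of Y, which is
    positive there. *)
Lemma det_tubemx_neq0 Z : tubemx Z -> \det Z != 0.
Proof.
move=> [X [Y [hX [hY pY] ->]]]; apply/negP => /det0P[v v0 vZ].
have x0 : v^t* != 0.
  by apply: contraNneq v0 => x0; rewrite -[v]trmxCK x0 trmx0 map_mx0.
have := pY _ x0; have : ((v^t*)^t* *m (X + 'i *: Y) *m v^t*) 0 0 = 0.
  by rewrite trmxCK vZ mul0mx mxE.
rewrite mxformD mxformZ => /(congr1 (fun z => 'Im z)).
by rewrite Im_rect ?hermmx_form_real // raddf0 => ->; rewrite ltxx.
Qed.

End Positive.

(** * Stability of mixed discriminants *)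

Lemma mixdet_tube_neq0 (C : numClosedFieldType) n (B : 'I_n -> 'M[C]_n)
    (pB : forall i, pdmx (B i)) m (Z : 'M[C]_n) :
  (m <= n)%N -> tubemx Z -> mixdet (fun i => if (i < m)%N then Z else B i) != 0.
Proof.
move=> le_mn; move: Z.
have [d mdn] : exists d, (m + d = n)%N by exists (n - m)%N; rewrite subnKC.
elim: d m mdn {le_mn} => [|d IHd] m mdn Z tZ.
  have /eq_mixdet -> : (fun i : 'I_n => if (i < m)%N then Z else B i) =1 fun=> Z.
    by move=> i; have := ltn_ord i; rewrite -{2}mdn addn0 => ->.
  by rewrite mixdet_const mulf_neq0 ?det_tubemx_neq0 // pnatr_eq0 -lt0n fact_gt0.
have lt_mn : (m < n)%N by rewrite -mdn addnS ltnS leq_addr.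
pose i0 := Ordinal lt_mn.
have {}IHd W : tubemx W -> mixdet (fun i => if (i < m.+1)%N then W else B i) != 0.
  by apply: IHd; rewrite addSnnS.
(* The line moves the first [m.+1] slots from [Z] in the direction [B i0] and freezes the others, so
   the induction hypothesis controls the roots of [f]. *)
pose P (W : 'M[C]_n) (i : 'I_n) := if (i < m.+1)%N then W else B i.
pose Q (W : 'M[C]_n) (i : 'I_n) := if (i < m.+1)%N then W else 0.
pose f := mixdet_line (P Z) (Q (B i0)).
have fE t : f.[t] = mixdet (P (Z + t *: B i0)).
  rewrite horner_mixdet_line; apply: eq_mixdet => i; rewrite /P /Q.
  by case: ifP => // _; rewrite scaler0 addr0.
have fN0 t : 0 <= 'Im t -> f.[t] != 0 by move=> ?; rewrite fE IHd //; apply: tubemxD.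
have f'E : f^`().[0] = m.+1%:R * mixdet (fun i => if (i < m)%N then Z else B i).
  rewrite deriv_mixdet_line (bigID (fun i : 'I_n => (i < m.+1)%N)) /=.
  rewrite [X in _ + X]big1 ?addr0 => [|i /negPf im]; last first.
    (* The direction in slot [i] is zero, and linearity in that slot gives M = M + M. *)
    set M := mixdet _; have : M = 1 * M + M.
      apply: (mixdet_linear (i := i)) => //.
      by rewrite eqxx /Q im scaler0 addr0.
    by rewrite mul1r -[LHS]addr0 => /addrI.
  rewrite (eq_bigr (fun=> mixdet (fun i => if (i < m)%N then Z else B i))).
    rewrite (big_ord_narrow (F := fun=> mixdet _) lt_mn).
    by rewrite sumr_const card_ord mulr_natl.
  (* By symmetry [B i0] can be moved from slot [i] to its own slot [i0], so all [m.+1] terms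
     agree. *)
  move=> i im; rewrite -[RHS](mixdet_perm _ (tperm i i0)).
  apply: eq_mixdet => l; rewrite /Q /P; case: tpermP => [->|->|/eqP li /eqP li0].
  - by rewrite eqxx im ltnn.
  - case: eqVneq => [<-|ii0]; first by rewrite ltnSn ltnn.
    move: im; rewrite ltnS leq_eqVlt -[_ == _]/(i == i0) eq_sym (negPf ii0) /=.
    by move=> ->; rewrite ltnSn.
  - by rewrite (negPf li) ltnS leq_eqVlt -[_ == _]/(l == i0) (negPf li0).
have [s fs] := closed_field_poly_normal f.
have lN0 : lead_coef f != 0.
  by rewrite lead_coef_eq0; apply: contraNneq (fN0 0 _) => [->|]; rewrite ?horner0 // raddf0.
have sIm z : z \in s -> 'Im z < 0.
  move=> zs; rewrite real_ltNge ?Creal_Im ?real0 //; apply/negP => /fN0/negP[].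
  by rewrite fs hornerZ mulf_eq0 -[X in _ || X]/(root _ _) root_prod_XsubC zs orbT.
have [w [wE _ w_lt0]] := log_deriv_prod_XsubC sIm.
(* If f were the constant c, then by homogeneity D(B + tZ, ...) = c t^(m+1) for
   t <> 0, hence for t = 0, where it does not vanish. *)
have sN0 : s != [::].
  apply/eqP => s0; move: fs; rewrite s0 big_nil alg_polyC => fs.
  set c := lead_coef f in fs lN0.
  pose k (i : 'I_n) : {poly C} := if (i < m.+1)%N then 'X else 1.
  pose g := mixdet_line (P (B i0)) (Q Z) - c *: \prod_(i < n) k i.
  have gE t : g.[t] = mixdet (P (B i0 + t *: Z)) - c * \prod_(i < n) (k i).[t].
    rewrite hornerD hornerN hornerZ horner_prod horner_mixdet_line.
    congr (_ - _); apply: eq_mixdet => i; rewrite /P /Q.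
    by case: ifP => // _; rewrite scaler0 addr0.
  have : g.[0] = 0.
    apply: horner_eq0_at0 => e e0; rewrite gE.
    have := fE e^-1; rewrite fs hornerC => ->.
    rewrite mulrC -mixdet_scale; apply/eqP; rewrite subr_eq0; apply/eqP.
    apply: eq_mixdet => i; rewrite /P /k; case: ifP => _; last by rewrite hornerC scale1r.
    by rewrite hornerX scalerDr scalerA divff ?gt_eqF // scale1r addrC.
  rewrite gE scale0r addr0 (bigD1 i0) //= {1}/k ltnSn hornerX mul0r mulr0 subr0.
  (* The matrix ['i *: B i0] lies in the tube; by homogeneity its value is a power of ['i] times the
     one that was found to vanish. *)
  apply/eqP; have := IHd _ (tubemx_imZ (pB i0)); apply: contraNneq => h.
  have /eq_mixdet -> : (fun i : 'I_n => if (i < m.+1)%N then 'i *: B i0 else B i)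
      =1 fun i => (if (i < m.+1)%N then 'i else 1) *: P (B i0) i.
    by move=> i; rewrite /P; case: ifP; rewrite ?scale1r.
  by rewrite mixdet_scale h mulr0.
have: f^`().[0] != 0.
  rewrite fs derivZ hornerZ wE !mulf_neq0 //.
    by apply: contraTneq (w_lt0 sN0) => ->; rewrite raddf0 ltxx.
  by have := fN0 0; rewrite raddf0 fs hornerZ mulf_eq0 negb_or => /(_ (lexx _))/andP[].
by rewrite f'E mulf_eq0 negb_or => /andP[].
Qed.

(** * Realness and positivity of mixed discriminants *)

Lemma mixdet_real (C : numClosedFieldType) n (A : 'I_n -> 'M[C]_n) :
  (forall i, A i \is hermsymmx) -> mixdet A \is Num.real.
Proof.
move=> hA; apply/CrealP; rewrite rmorph_mixdet -mixdet_tr.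
by apply: eq_mixdet => i; rewrite map_trmx; apply/hermmxP.
Qed.

(** The matrices are changed one at a time from the identity to [A i]. A change of sign would
    produce a zero at a positive definite family, against stability. *)
Lemma mixdet_pd_gt0 (C : numClosedFieldType) n (A : 'I_n -> 'M[C]_n) :
  (forall i, pdmx (A i)) -> 0 < mixdet A.
Proof.
have mixdetN0 (B : 'I_n -> 'M[C]_n) : (forall i, pdmx (B i)) -> mixdet B != 0.
  move=> pB; have := mixdet_tube_neq0 pB (leq0n n) (tubemx_imZ (pdmx1 C n)).
  by rewrite (@eq_mixdet _ _ _ B).
move=> pA; pose F m (i : 'I_n) : 'M[C]_n := if (i < m)%N then A i else 1%:M.
have pF m i : pdmx (F m i) by rewrite /F; case: ifP => // _; apply: pdmx1.
suff F_gt0 m : (m <= n)%N -> 0 < mixdet (F m).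
  rewrite (_ : mixdet A = mixdet (F n)) ?F_gt0 //.
  by apply: eq_mixdet => i; rewrite /F ltn_ord.
elim: m => [_|m IHm lt_mn].
  by rewrite (@eq_mixdet _ _ _ (fun=> 1%:M)) // mixdet_const det1 mulr1 ltr0n fact_gt0.
have {}IHm := IHm (ltnW lt_mn).
rewrite real_ltNge ?real0 ?mixdet_real // => [|i]; last by case: (pF m.+1 i).
apply/negP => le0; have lt0 : mixdet (F m.+1) < 0 by rewrite lt_neqAle mixdetN0.
(* This is the zero of the affine function t D(F (m+1)) + D(F m), positive because the two values
   have opposite signs. *)
pose t := mixdet (F m) / - mixdet (F m.+1).
have t_gt0 : 0 < t by rewrite divr_gt0 // oppr_gt0.
pose i0 := Ordinal lt_mn.
pose G (i : 'I_n) := if i == i0 then t *: A i + 1%:M else F m i.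
have : mixdet G = 0.
  rewrite (@mixdet_linear _ _ i0 t (F m.+1) (F m)).
  - by rewrite /t invrN mulrN mulNr divfK ?addNr // lt_eqF.
  - move=> j /negPf ji; rewrite /G ji /F ltnS leq_eqVlt.
    by rewrite -[X in X || _]/(j == i0) ji.
  - by move=> j /negPf ji; rewrite /G ji.
  - by rewrite /G eqxx /F ltnn ltnSn.
apply/eqP/mixdetN0 => i; rewrite /G; case: eqP => // _.
by apply: pdmxD; [apply: pdmxZ | apply/pdmx_psd/pdmx1].
Qed.

(** * Positive semi-definite matrices and their determinants *)

Lemma det_psdmx_ge0 (C : numClosedFieldType) n (M : 'M[C]_n) :
  psdmx M -> 0 <= \det M.
Proof.
move=> [hM pM]; have /orthomx_spectralP ME := hermitian_normalmx hM.
set P := spectralmx M in ME; set D := spectral_diag M in ME.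
have uP : P \is unitarymx := spectral_unitarymx M.
have PU : P \in unitmx := spectral_unit M.
have -> : \det M = \prod_i D 0 i.
  rewrite ME !det_mulmx mulrAC -det_mulmx mulVmx // det1 mul1r.
  exact: det_diag.
apply: prodr_ge0 => i _.
(* Each eigenvalue is the value of the form at a conjugated row of the unitary matrix [P]. *)
have -> : D 0 i = (P *m M *m P^t*) i i.
  rewrite ME -(invmx_unitary uP) !mulmxA mulmxV // mul1mx -mulmxA mulmxV // mulmx1.
  by rewrite mxE eqxx mulr1n.
have -> : (P *m M *m P^t*) i i = (((row i P)^t*)^t* *m M *m (row i P)^t*) 0 0.
  rewrite trmxCK -row_mul [LHS]mxE [RHS]mxE. apply: eq_bigr => j _.
  by congr (_ * _); [rewrite [RHS]mxE | rewrite !mxE].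
exact: pM.
Qed.

(* The form of a real symmetric matrix at [u + 'i v] is the sum of its values
   at [u] and [v]. *)
Lemma realsym_psdmx (C : numClosedFieldType) n (M : 'M[C]_n) :
    (forall i j, M i j \is Num.real) -> M^T = M ->
    (forall u : 'cV[C]_n, (forall i, u i 0 \is Num.real) -> 0 <= (u^T *m M *m u) 0 0) ->
  psdmx M.
Proof.
move=> rM sM pM; split.
  by apply/hermmxP; rewrite sM; apply/matrixP => i j; rewrite mxE; apply/CrealP.
move=> x; pose u := \col_i 'Re (x i 0); pose v := \col_i 'Im (x i 0).
have -> : x = u + 'i *: v by apply/colP => i; rewrite !mxE -Crect.
have -> : (u + 'i *: v)^t* = u^T - 'i *: v^T.
  apply/rowP => i; rewrite !mxE rmorphD rmorphM /= conjCi mulNr.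
  by rewrite !(CrealP _) ?Creal_Re ?Creal_Im.
have uMv : (u^T *m M *m v) 0 0 = (v^T *m M *m u) 0 0.
  have -> : v^T *m M *m u = (u^T *m M *m v)^T by rewrite !trmx_mul trmxK sM mulmxA.
  by rewrite [RHS]mxE.
have -> : ((u^T - 'i *: v^T) *m M *m (u + 'i *: v)) 0 0 =
    (u^T *m M *m u) 0 0 + (v^T *m M *m v) 0 0.
  have mxD (X Y : 'M[C]_1) : (X + Y) 0 0 = X 0 0 + Y 0 0 by rewrite mxE.
  have mxN (X : 'M[C]_1) : (- X) 0 0 = - X 0 0 by rewrite mxE.
  have mxZ a (X : 'M[C]_1) : (a *: X) 0 0 = a * X 0 0 by rewrite mxE.
  rewrite !(mulmxDl, mulmxDr, mulNmx) -!scalemxAl -!scalemxAr.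
  by rewrite !(mxD, mxN, mxZ) uMv addrA subrK mulrA -expr2 sqrCi mulN1r opprK.
by apply: addr_ge0; apply: pM => i; rewrite mxE ?Creal_Re ?Creal_Im.
Qed.

(** * The symmetric bilinear form Q *)

Definition mdform (F : fieldType) n (B : n.-tuple 'M[F]_n.+2) (X Y : 'M[F]_n.+2) : F :=
  mixed_discriminant [tuple of X :: Y :: B].

Lemma mdformC (F : fieldType) n (B : n.-tuple 'M[F]_n.+2) X Y :
  mdform B X Y = mdform B Y X.
Proof.
rewrite /mdform !mixed_discriminantE; congr (_ * _).
rewrite -(mixdet_perm _ (tperm ord0 (lift ord0 ord0))); apply: eq_mixdet => i.
case: tpermP => [->|->|/eqP i0 /eqP i1]; rewrite !(tnth_nth 0) //=.
by case: i i0 i1 => [[|[|i]] ?].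
Qed.

Lemma mdform_linear (F : fieldType) n (B : n.-tuple 'M[F]_n.+2) a X X' Y :
  mdform B (a *: X + X') Y = a * mdform B X Y + mdform B X' Y.
Proof.
rewrite /mdform !mixed_discriminantE mulrCA -mulrDr; congr (_ * _).
by apply: (mixdet_linear (i := ord0)) => [[[|i] ?] //|[[|i] ?] //|];
  rewrite !(tnth_nth 0).
Qed.

Lemma mdform0 (F : fieldType) n (B : n.-tuple 'M[F]_n.+2) Y : mdform B 0 Y = 0.
Proof.
have := mdform_linear B 1 0 0 Y.
by rewrite scaler0 addr0 mul1r -[LHS]addr0 => /addrI.
Qed.

Lemma mdform_sum (F : fieldType) n (B : n.-tuple 'M[F]_n.+2) (I : finType) (u : I -> F)
    (X : I -> 'M[F]_n.+2) Y :
  mdform B (\sum_i u i *: X i) Y = \sum_i u i * mdform B (X i) Y.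
Proof.
apply: (big_ind2 (fun Z z => mdform B Z Y = z)) => [|X1 x1 X2 x2 <- <-|i _].
- exact: mdform0.
- by have := mdform_linear B 1 X1 X2 Y; rewrite scale1r mul1r.
- by rewrite -[_ *: _]addr0 mdform_linear mdform0 addr0.
Qed.

(** * Alexandrov's inequality *)

Section Lorentz.
Variables (C : numClosedFieldType) (n : nat) (B : n.-tuple 'M[C]_n.+2).
Hypothesis pB : forall k, pdmx (tnth B k).

Let tnth_consP (P : 'M[C]_n.+2 -> Prop) X Y : P X -> P Y ->
  (forall k, P (tnth B k)) -> forall i, P (tnth [tuple of X :: Y :: B] i).
Proof.
move=> PX PY PB [[|[|i]] ilt]; rewrite (tnth_nth 0) //=.
have i_n : (i < n)%N by [].
by have := PB (Ordinal i_n); rewrite (tnth_nth 0).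
Qed.

Lemma mdform_real X Y : X \is hermsymmx -> Y \is hermsymmx ->
  mdform B X Y \is Num.real.
Proof.
move=> hX hY; rewrite /mdform mixed_discriminantE.
rewrite realM ?realV ?realn // mixdet_real //.
by apply: (@tnth_consP (fun M => M \is hermsymmx) X Y) => // k; case: (pB k).
Qed.

Lemma mdform_gt0 X Y : pdmx X -> pdmx Y -> 0 < mdform B X Y.
Proof.
move=> pX pY; rewrite /mdform mixed_discriminantE.
rewrite mulr_gt0 ?invr_gt0 ?ltr0n ?fact_gt0 // mixdet_pd_gt0 //.
exact: (@tnth_consP (@pdmx C n.+2)).
Qed.

Lemma mdform_tube_neq0 Z : tubemx Z -> mdform B Z Z != 0.
Proof.
move=> tZ; rewrite /mdform mixed_discriminantE mulf_neq0 //.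
  by rewrite invr_eq0 pnatr_eq0 -lt0n fact_gt0.
(* The identity is a placeholder in the first two slots, which [Z] overwrites for m = 2. *)
have p1 := pdmx1 C n.+2.
have := mixdet_tube_neq0 (@tnth_consP (@pdmx C n.+2) _ _ p1 p1 pB) (isT : (2 <= n.+2)%N) tZ.
congr (_ != 0); by apply: eq_mixdet => -[[|[|i]] ilt]; rewrite !(tnth_nth 0).
Qed.

(* If the inequality failed, the real quadratic polynomial
   [s |-> mdform B (X + s *: A) (X + s *: A)] would have a root in the open
   upper half plane. *)
Lemma alexandrov A X : pdmx A -> X \is hermsymmx ->
  mdform B A A * mdform B X X <= mdform B A X ^+ 2.
Proof.
move=> pA hX; have [hA _] := pA.
have a_gt0 := mdform_gt0 pA pA.
set a := mdform B A A in a_gt0 *; set b := mdform B A X; set c := mdform B X X.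
have aR : a \is Num.real := gtr0_real a_gt0.
have bR : b \is Num.real := mdform_real hA hX.
have cR : c \is Num.real := mdform_real hX hX.
have [//|] := real_leP (rpredM aR cR) (rpredX 2 bR); rewrite -subr_gt0.
set D := _ - _ => D_gt0; pose q := sqrtC D.
have q_gt0 : 0 < q by rewrite sqrtC_gt0.
have qq : q ^+ 2 = D by rewrite sqrtCK.
(* The root of a s^2 + 2 b s + c with positive imaginary part. *)
pose s := - b / a + 'i * (q / a).
have tZ : tubemx (s *: A + X).
  exists (- b / a *: A + X), (q / a *: A); split.
  - by rewrite hermmxD // hermmxZ // rpredM ?rpredN ?rpredV.
  - by apply: pdmxZ => //; rewrite divr_gt0.
  - by rewrite scalerDl scalerA addrAC.
have /eqP[] := mdform_tube_neq0 tZ.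
rewrite mdform_linear mdformC mdform_linear -/a (mdformC _ X (_ + _)) mdform_linear.
rewrite -/b -/c (mdformC _ X A) -/b.
have aN0 : a != 0 by rewrite gt_eqF.
have -> : s * (s * a + b) + (s * b + c) = ((s * a + b) ^+ 2 + (a * c - b ^+ 2)) / a.
  by field.
have -> : s * a + b = 'i * q by rewrite /s; field.
by rewrite exprMn sqrCi mulN1r qq addNr mul0r.
Qed.

End Lorentz.

(** * The two determinants for positive definite matrices *)

(** With a = d_00, multiplying d on the left by the block matrix with rows (1, 0) and (b, -a) clears
    b below a. This is elimination without division, so a = 0 is allowed. *)
Lemma det_schur_scaled (F : fieldType) r (d : 'M[F]_r.+1) :
    (forall i j, d i j = d j i) ->
  d 0 0 * \det (\matrix_(i < r, j < r)
     (d 0 (lift ord0 i) * d 0 (lift ord0 j) - d 0 0 * d (lift ord0 i) (lift ord0 j)))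
  = (- d 0 0) ^+ r * \det d.
Proof.
move=> dC; set M := \matrix_(i, j) _.
pose a := d 0 0; pose b : 'cV[F]_r := \col_i d 0 (lift ord0 i).
pose q : 'M[F]_r := \matrix_(i, j) d (lift ord0 i) (lift ord0 j).
have dE : d = block_mx a%:M b^T b q :> 'M_(1 + r).
  rewrite -[LHS](@submxK _ 1 r 1 r); congr block_mx; apply/matrixP => i j.
  - by rewrite !mxE !ord1 !lshift0 eqxx.
  - by rewrite !mxE ord1 lshift0 rshift1.
  - by rewrite !mxE ord1 lshift0 rshift1 dC.
  - by rewrite !mxE !rshift1.
have -> : \det d = \det (block_mx a%:M b^T b q) by rewrite -dE.
have -> : (- d 0 0) ^+ r = \det (block_mx 1%:M 0 b (- a)%:M : 'M_(1 + r)).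
  by rewrite det_lblock det1 mul1r det_scalar.
rewrite -det_mulmx mulmx_block !mul1mx !mul0mx !addr0.
have -> : b *m a%:M + (- a)%:M *m b = 0.
  by rewrite mul_mx_scalar mul_scalar_mx scaleNr subrr.
rewrite det_ublock det_scalar1; congr (_ * \det _).
apply/matrixP => i j; rewrite mul_scalar_mx !mxE big_ord1 !mxE.
by rewrite mulNr.
Qed.

Section PositiveDefinite.
Variables (C : numClosedFieldType) (n r : nat) (B : n.-tuple 'M[C]_n.+2).
Variable (A : 'I_r.+1 -> 'M[C]_n.+2).
Hypothesis pB : forall k, pdmx (tnth B k).
Hypothesis pA : forall i, pdmx (A i).
Let d i j := mdform B (A i) (A j).

Lemma det_reverse_gram_pd : 0 <= \det (\matrix_(i < r, j < r)
  (d ord0 (lift ord0 i) * d ord0 (lift ord0 j)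
   - d ord0 ord0 * d (lift ord0 i) (lift ord0 j))).
Proof.
have hA i : A i \is hermsymmx by case: (pA i).
have dR i j : d i j \is Num.real by apply: mdform_real.
apply/det_psdmx_ge0/realsym_psdmx => [i j||u uR].
- by rewrite mxE; apply: rpredB; apply: rpredM; apply: dR.
- apply/matrixP => i j; rewrite !mxE; congr (_ - _ * _); first exact: mulrC.
  exact: mdformC.
(* By bilinearity the form at [u] is Q(A_0, X)^2 - Q(A_0, A_0) Q(X, X). *)
pose X := \sum_i u i 0 *: A (lift ord0 i).
have hX : X \is hermsymmx.
  apply: (big_ind (fun M => M \is hermsymmx)) => [|M N|i _].
  - by apply/hermmxP; rewrite trmx0 map_mx0.
  - exact: hermmxD.
  - exact: hermmxZ.
have := alexandrov pB (pA ord0) hX; rewrite -subr_ge0; congr (_ <= _).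
rewrite [in RHS]mxE.
have XE Y : mdform B Y X = \sum_i u i 0 * mdform B Y (A (lift ord0 i)).
  by rewrite mdformC mdform_sum; apply: eq_bigr => i _; rewrite mdformC.
rewrite expr2 (XE (A ord0)) [X in X - _]mulr_sumr (XE X) [X in _ - X]mulr_sumr.
rewrite -sumrB; apply: eq_bigr => j _; rewrite [in RHS]mxE !mulr_suml mdform_sum.
rewrite !mulr_sumr -sumrB; apply: eq_bigr => i _; rewrite !mxE /d.
by ring.
Qed.

Lemma det_gram_pd : 0 <= (-1) ^+ r * \det (\matrix_(i, j) d i j).
Proof.
set D := \matrix_(i, j) _.
have a_gt0 : 0 < d ord0 ord0 by apply: mdform_gt0.
(* Multiplication by the positive number d_00^r produces the right-hand side of
   [det_schur_scaled]. *)
rewrite -(pmulr_rge0 _ (exprn_gt0 r a_gt0)) mulrA -exprMn mulrN1.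
have DC i j : D i j = D j i by rewrite !mxE /d mdformC.
have := det_schur_scaled DC; rewrite [D 0 0]mxE => <-.
apply: mulr_ge0; first exact: ltW.
have := det_reverse_gram_pd; congr (_ <= \det _).
by apply/matrixP => i j; rewrite !mxE.
Qed.
End PositiveDefinite.

(** * Reduction of the semi-definite case to the definite one *)

Lemma horner_det (R : comNzRingType) n (M : 'M[{poly R}]_n) x :
  (\det M).[x] = \det (map_mx (fun p => p.[x]) M).
Proof. by rewrite -horner_evalE -det_map_mx. Qed.

(* The dimension is n.+2, and B lists the matrices B_3, ..., B_(n.+2). *)
Theorem corollary3p6 (R : realType) (n r : nat) (hr : (1 <= r)%N)
    (A : 'I_r.+1 -> 'M[R[i]]_n.+2) (B : n.-tuple 'M[R[i]]_n.+2)
    (hA : forall i : 'I_r.+1, psdmx (A i))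
    (hB : forall k : 'I_n, psdmx (tnth B k)) :
  let d (i j : 'I_r.+1) : R[i] :=
    mixed_discriminant [tuple of A i :: A j :: B] in
  0 <= \det (\matrix_(i < r, j < r)
               (d ord0 (lift ord0 i) * d ord0 (lift ord0 j)
                - d ord0 ord0 * d (lift ord0 i) (lift ord0 j)))
  /\ 0 <= (-1) ^+ r * \det (\matrix_(i < r.+1, j < r.+1) d i j).
Proof.
move=> d.
pose Ae e i := A i + e *: 1%:M.
pose Be e : n.-tuple 'M[R[i]]_n.+2 := [tuple of map (fun M => M + e *: 1%:M) B].
(* The entry d_ij as a polynomial in e, with every argument, including the matrices of [B], shifted
   by e I. *)
pose p i j : {poly R[i]} := (n.+2`!%:R)^-1 *:
  mixdet_line (tnth [tuple of A i :: A j :: B]) (fun=> 1%:M).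
have pE e i j : (p i j).[e] = mdform (Be e) (Ae e i) (Ae e j).
  rewrite hornerZ horner_mixdet_line /mdform mixed_discriminantE; congr (_ * _).
  apply: eq_mixdet => -[[|[|k]] klt]; rewrite !(tnth_nth 0) //=.
  by rewrite (nth_map 0) // size_tuple.
have p0 i j : (p i j).[0] = d i j.
  rewrite hornerZ horner_mixdet_line /d mixed_discriminantE; congr (_ * _).
  by apply: eq_mixdet => k; rewrite scale0r addr0.
have pAe e i : 0 < e -> pdmx (Ae e i).
  by move=> e0; rewrite /Ae addrC; apply: pdmxD => //; apply/pdmxZ/pdmx1.
have pBe e k : 0 < e -> pdmx (tnth (Be e) k).
  by move=> e0; rewrite tnth_map addrC; apply: pdmxD => //; apply/pdmxZ/pdmx1.
split.
  pose P := \det (\matrix_(i < r, j < r) (p ord0 (lift ord0 i) * p ord0 (lift ord0 j)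
                - p ord0 ord0 * p (lift ord0 i) (lift ord0 j))).
  have : 0 <= P.[0].
    apply: horner_ge0_at0 => e e0.
    have := det_reverse_gram_pd (pBe e ^~ e0) (pAe e ^~ e0).
    congr (_ <= _); rewrite horner_det; congr (\det _).
    by apply/matrixP => i j; rewrite !mxE hornerD hornerN !hornerM !pE.
  congr (_ <= _); rewrite horner_det; congr (\det _).
  by apply/matrixP => i j; rewrite !mxE hornerD hornerN !hornerM !p0.
pose P := (-1) ^+ r *: \det (\matrix_(i < r.+1, j < r.+1) p i j).
have : 0 <= P.[0].
  apply: horner_ge0_at0 => e e0.
  have := det_gram_pd (pBe e ^~ e0) (pAe e ^~ e0).
  congr (_ <= _); rewrite hornerZ horner_det; congr (_ * \det _).
  by apply/matrixP => i j; rewrite !mxE pE.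
congr (_ <= _); rewrite hornerZ horner_det; congr (_ * \det _).
by apply/matrixP => i j; rewrite !mxE p0.
Qed.
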